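(* Let $a,b\in(0,\infty)$ and let $f\in\mathcal{F}$ be a solution of the functional equation $$f(t)=f(at)+f(bt)\qquad\text{for all } t\ge 0.$$ Then $a,b\in(0,1)$ and there exist $p>0$ and a continuous function $H\colon(0,\infty)\to\mathbb{R}\setminus\{0\}$ such that $H(t)=H(at)=H(bt)$ for every $t>0$, and $$f(t)=t^{p}H(t),\qquad t>0.$$ Moreover, if $\ln a/\ln b$ is irrational, then the function $H$ is constant.
   Context: $\mathcal{F}$ denotes the set of all continuous functions $f\colon[0,\infty)\to\mathbb{R}$ such that $f(0)=0$ and $0$ is an isolated point of the zero set $\{x\in[0,\infty)\colon f(x)=0\}$. *)

(* Defs.v *)
From mathcomp Require Import all_boot all_order all_algebra.
From mathcomp Require Import all_classical all_reals all_analysis.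
Import Order.TTheory GRing.Theory Num.Theory.
Import numFieldNormedType.Exports.

Set Implicit Arguments.
Unset Strict Implicit.
Unset Printing Implicit Defensive.

Local Open Scope classical_set_scope.
Local Open Scope ring_scope.

(* A function [0, oo) -> R is represented by a total f : R -> R of which only
   the values on [0, oo) are constrained; continuity is relative to that
   half-line.  The zero set is taken inside [0, oo), and being isolated in
   it for the topology of R is the same as for the subspace topology. *)
Definition classF (R : realType) : set (R -> R) :=
  [set f : R -> R |
    [/\ {within `[0, +oo[, continuous f},
        f 0 = 0
      & isolated [set x : R | 0 <= x /\ f x = 0] 0]].

(* Main.v *)
(** A solution [f] is positive, up to sign.  Put [g x := f (expR (- x))],
    [A := - ln a] and [B := - ln b], so that [g x = g (x + A) + g (x + B)].
    Then [g (m A + n B)] is a Hausdorff moment sequence, the moments of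
    [theta^m (1 - theta)^n], which gives
    [g (x + 2 A) - 2 c g (x + A) + c^2 g x >= 0] for every [c].  If
    [a^p + b^p = 1], then [h x := expR (p x) g x] is therefore midpoint convex
    along [A] and along [B], while [h x] is a proper average of [h (x + A)] and
    [h (x + B)].  A positive difference [h (x + A) - h x] can then only grow
    along the points [x + i A - j B], so [h] would grow without bound on those of
    them that stay in [[x, x + B]]; hence [A] and [B] are periods of [h]. *)
Require Import Defs.
From mathcomp Require Import all_boot all_order all_algebra.
From mathcomp Require Import all_classical all_reals all_analysis.
From mathcomp Require Import ring lra.
Import Order.TTheory GRing.Theory Num.Theory.
Import numFieldNormedType.Exports.

Set Implicit Arguments.
Unset Strict Implicit.
Unset Printing Implicit Defensive.

Local Open Scope classical_set_scope.
Local Open Scope ring_scope.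

(** * Moment inequalities for the iterated equation *)

(* Iterating the equation n times weighs each x + k A + (n - k) B by 'C(n, k);
   the right-hand side is the sum of (k - c)^2 against these masses. *)
Lemma binomial_variance_ge0 (R : realType) (g : R -> R) (A B : R) :
    (forall x, 0 <= g x) -> (forall x, g x = g (x + A) + g (x + B)) ->
  forall n x c, 0 <= n%:R * (n%:R - 1) * g (x + A + A)
    + n%:R * (1 - c *+ 2) * g (x + A) + c ^+ 2 * g x.
Proof.
move=> g_ge0 gE; elim=> [|n IHn] x c.
  by rewrite !mul0r !add0r mulr_ge0 ?sqr_ge0.
(* A first step [A] leaves a count to be compared with [c - 1], a first step [B] one to be compared
   with [c]. *)
have := addr_ge0 (IHn (x + A) (c - 1)) (IHn (x + B) c).
have -> : x + B + A + A = x + A + A + B by ring.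
have -> : x + B + A = x + A + B by ring.
have := gE (x + A + A); have := gE (x + A); have := gE x.
set w0 := g x; set w1 := g (x + A); set w2 := g (x + A + A).
set w3 := g (x + A + A + A) => -> E1 E2.
congr (0 <= _); rewrite -natr1 E2 E1; ring: E1 E2.
Qed.

(** This is the coefficient of [n ^+ 2] in the variance inequality taken at [n * c]; a negative
    value would violate that inequality for large [n]. *)
Lemma second_difference_ge0 (R : realType) (g : R -> R) (A B : R) :
    (forall x, 0 <= g x) -> (forall x, g x = g (x + A) + g (x + B)) ->
  forall x c, 0 <= g (x + A + A) - c *+ 2 * g (x + A) + c ^+ 2 * g x.
Proof.
move=> g_ge0 gE x c; rewrite leNgt; apply/negP => L_lt0.
set L := (X in X < 0) in L_lt0.
pose n := (Num.truncn ((g (x + A) - g (x + A + A)) / - L)).+1.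
have n_gt0 : 0 < n%:R :> R by rewrite ltr0n.
have nL : g (x + A) - g (x + A + A) < n%:R * - L.
  by rewrite -ltr_pdivrMr ?oppr_gt0// truncnS_gt.
have := binomial_variance_ge0 g_ge0 gE n x (n%:R * c).
have -> : n%:R * (n%:R - 1) * g (x + A + A) +
  n%:R * (1 - (n%:R * c) *+ 2) * g (x + A) + (n%:R * c) ^+ 2 * g x =
  n%:R * (n%:R * L + (g (x + A) - g (x + A + A))) by rewrite /L; ring.
rewrite pmulr_rge0//; lra.
Qed.

(** * Periodicity of convex averages *)

Lemma forward_difference_le0 (R : realType) (h : R -> R) (A B al be : R) :
    0 < A -> 0 < B -> 0 < al -> 0 < be -> al + be = 1 -> continuous h ->
    (forall x, h x = al * h (x + A) + be * h (x + B)) ->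
    (forall x, h (x + A) *+ 2 <= h (x + A + A) + h x) ->
    (forall x, h (x + B) *+ 2 <= h (x + B + B) + h x) ->
  forall x, h (x + A) <= h x.
Proof.
move=> A0 B0 al0 be0 albe h_cont hE cvxA cvxB x; rewrite leNgt; apply/negP => hx.
pose dA y := h (y + A) - h y; pose dB y := h (y + B) - h y.
have dAB y : al * dA y + be * dB y = 0.
  rewrite /dA /dB; have := hE y; have -> : al = 1 - be by lra.
  move=> E; lra.
have dAS y : dA y <= dA (y + A) by rewrite /dA; have := cvxA y; lra.
have dBS y : dB y <= dB (y + B) by rewrite /dB; have := cvxB y; lra.
(* Since [dB] is a negative multiple of [dA], convexity along [B] makes [dA] nonincreasing along
   [B]. *)
have dA_B y : dA (y + B) <= dA y.
  have := dBS y; have := dAB y; have := dAB (y + B) => E1 E2 le.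
  rewrite -(ler_pM2l al0); have := ler_wpM2l (ltW be0) le.
  move: (al * _) (al * _) (be * _) (be * _) E1 E2 => *; lra.
have [d d0 ledx] : exists2 d, 0 < d & d <= dA x.
  by exists (dA x) => //; rewrite subr_gt0.
have dA_ge i j : d <= dA (x + A *+ i - B *+ j).
  elim: j => [|j IHj].
    rewrite subr0; elim: i => [|i IHi]; first by rewrite addr0.
    by rewrite mulrSr addrA (le_trans IHi).
  apply: (le_trans IHj); apply: (le_trans _ (dA_B _)).
  by rewrite mulrSr opprD addrA subrK.
(* A step [+ A] gains at least [d]; a step [- B] loses nothing, because [dA > 0] forces [dB < 0]. *)
have h_ge i j : h x + d *+ i <= h (x + A *+ i - B *+ j).
  elim: j => [|j IHj].
    rewrite subr0; elim: i => [|i IHi]; first by rewrite !addr0.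
    have := dA_ge i 0; rewrite subr0 /dA !mulrSr !addrA.
    move: (d *+ i) IHi => di ? ?; lra.
  apply: (le_trans IHj); set z := x + A *+ i - B *+ j.+1.
  have -> : x + A *+ i - B *+ j = z + B by rewrite /z mulrSr opprD addrA subrK.
  have dz : 0 < dA z by apply: lt_le_trans (dA_ge _ _).
  have := dAB z => E; have : be * dB z < 0 by have := mulr_gt0 al0 dz; lra.
  by rewrite pmulr_rlt0// /dB subr_lt0 => /ltW.
have [|c _ hc] := @EVT_max _ h x (x + B) _ (continuous_subspaceT h_cont).
  lra.
pose i := (Num.truncn ((h c - h x) / d)).+1.
have hi : h c - h x < d *+ i by rewrite -mulr_natl -ltr_pdivrMr// truncnS_gt.
(* This [j] brings the point back into [[x, x + B)], where [h] is at most [h c]. *)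
pose j := Num.truncn (A *+ i / B).
have /andP[j1 j2] : j%:R <= A *+ i / B < j.+1%:R.
  by apply: truncn_itv; rewrite divr_ge0 ?mulrn_wge0 ?ltW.
have := h_ge i j; rewrite leNgt; move/negP; apply.
apply: (@le_lt_trans _ _ (h c)); last by rewrite -ltrBlDl.
apply: hc; rewrite in_itv/=; move: j1 j2.
rewrite ler_pdivlMr// ltr_pdivrMr// !mulr_natl (mulrSr B j).
by move: (A *+ i) (B *+ j) => Ai Bj le1 lt2; apply/andP; split; lra.
Qed.

(** Both forward differences are at most 0 and their weighted sum is 0, so both vanish. *)
Lemma convex_harmonic_periodic (R : realType) (h : R -> R) (A B al be : R) :
    0 < A -> 0 < B -> 0 < al -> 0 < be -> al + be = 1 -> continuous h ->
    (forall x, h x = al * h (x + A) + be * h (x + B)) ->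
    (forall x, h (x + A) *+ 2 <= h (x + A + A) + h x) ->
    (forall x, h (x + B) *+ 2 <= h (x + B + B) + h x) ->
  forall x, h (x + A) = h x /\ h (x + B) = h x.
Proof.
move=> A0 B0 al0 be0 albe h_cont hE cvxA cvxB x.
have leA : h (x + A) <= h x by exact: (forward_difference_le0 A0 B0 al0 be0).
have leB : h (x + B) <= h x.
  apply: (forward_difference_le0 B0 A0 be0 al0) => //; first by rewrite addrC.
  by move=> y; rewrite addrC.
have := hE x; have -> : al = 1 - be by lra.
have be1 : 0 < 1 - be by lra.
have := ler_wpM2l (ltW be0) leB; have := ler_wpM2l (ltW be1) leA => le1 le2 E.
by split; apply/eqP; rewrite eq_le ?leA ?leB /=;
  [rewrite -(ler_pM2l be1)|rewrite -(ler_pM2l be0)]; lra.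
Qed.

(** * Incommensurable periods *)

(** Otherwise the subgroup [G] has a least positive element, which generates it, and [A / B] is
    rational. *)
Lemma small_period (R : realType) (G : set R) (A B : R) :
    G A -> G B -> 0 < A -> (forall x y, G x -> G y -> G (x - y)) ->
    irrational (A / B) ->
  forall e, 0 < e -> exists2 g, G g & 0 < g < e.
Proof.
move=> GA GB A0 GD irr e e0; apply: contrapT => nog.
have G0 : G 0 by rewrite -(subrr A); exact: GD.
have GN x : G x -> G (- x) by rewrite -(sub0r x); exact: GD.
have GZ x (m : int) : G x -> G (x *~ m).
  have GM x' (n : nat) : G x' -> G (x' *+ n).
    move=> Gx; elim: n => [//|n IHn]; rewrite mulrSr -[X in _ + X]opprK.
    by apply: GD => //; exact: GN.
  by case: m => n Gx; [exact: GM|rewrite NegzE mulrNz; apply: GN; exact: GM].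
pose P := [set g | G g /\ 0 < g].
have infP : has_inf P.
  by split; [exists A|exists 0 => g [_ /ltW]].
have [g [Gg g0] ginf] := inf_adherent e0 infP.
(* As [g] is within [e] of [inf P], a smaller positive [g'] would make [g - g'] an element that
   [nog] forbids. *)
have gmin g' : G g' -> 0 < g' -> g <= g'.
  move=> Gg' g'0; rewrite leNgt; apply/negP => lt_g'g; apply: nog.
  exists (g - g'); first exact: GD.
  have : inf P <= g' by apply: ge_inf => //; case: infP.
  by move=> ?; apply/andP; split; lra.
have multiple x : G x -> exists m : int, x = m%:~R * g.
  move=> Gx; exists (Num.floor (x / g)).
  have /andP[] := floor_itv (x / g); set m := Num.floor _.
  rewrite ler_pdivlMr// ltr_pdivrMr// intrD mulrDl mul1r => le1 lt2.
  have Gr : G (x - m%:~R * g) by apply: GD => //; rewrite mulrzl; exact: GZ.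
  apply/eqP; rewrite eq_le le1 andbT leNgt; apply/negP => lt1.
  have := gmin _ Gr; rewrite subr_gt0 => /(_ lt1); lra.
have [m Am] := multiple _ GA; have [n Bn] := multiple _ GB.
(* If [B] is 0 then so is [n], and both quotients are 0 by the convention for inverses. *)
apply: irr; exists (m%:~R / n%:~R) => //.
by rewrite fmorph_div/= !ratr_int Am Bn -mulf_div divff ?mulr1 ?gt_eqF.
Qed.

(** Multiples of an arbitrarily small period come arbitrarily close to [x], and [h] takes the value
    [h 0] at all of them. *)
Lemma continuous_incommensurable_periods (R : realType) (h : R -> R) (A B : R) :
    continuous h -> (forall x, h (x + A) = h x) -> (forall x, h (x + B) = h x) ->
    0 < A -> irrational (A / B) ->
  forall x, h x = h 0.
Proof.
move=> h_cont hA hB A0 irr x.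
pose G := [set g | forall y, h (y + g) = h y].
have GD u v : G u -> G v -> G (u - v).
  by move=> Gu Gv y; rewrite -(Gv (y + (u - v))) addrA subrK Gu.
apply/eqP; rewrite -subr_eq0 -normr_le0; apply/ler_addgt0Pl => e e0.
rewrite addr0.
have /cvgrPdist_le /(_ _ e0) [d /= d0 hd] := h_cont x.
have [g Gg /andP[g0 gd]] := @small_period _ G A B hA hB A0 GD irr d d0.
have G0 : G 0 by move=> y; rewrite addr0.
have hmul (m : int) : h (g *~ m) = h 0.
  elim: m => [//|n IHn|n IHn].
    by rewrite -addn1 PoszD mulrzDr Gg.
  by rewrite -IHn -Gg -addn1 PoszD opprD mulrzDr mulrN1z subrK.
rewrite -(hmul (Num.floor (x / g))); apply: hd => /=.
have /andP[] := floor_itv (x / g); set m := Num.floor _.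
rewrite ler_pdivlMr// ltr_pdivrMr// intrD mulrDl mul1r !mulrzl => le1 lt2.
rewrite ger0_norm; lra.
Qed.

(** * The exponent and the modulated function *)

Lemma exists_exponent (R : realType) (A B : R) : 0 < A -> 0 < B ->
  exists2 p : R, 0 < p & expR (- (p * A)) + expR (- (p * B)) = 1.
Proof.
move=> A0 B0; pose F (p : R) : R := expR (- (p * A)) + expR (- (p * B)).
have F_cont : continuous F.
  by move=> p; apply: cvgD; apply: continuous_comp;
    [| exact: continuous_expR | | exact: continuous_expR];
    apply: cvgN; apply: cvgMl; exact: cvg_id.
(* With this [q] both [q * A] and [q * B] are at least 1, so each exponential is at most 1/2. *)
pose q := A^-1 + B^-1.
have q0 : 0 < q by rewrite addr_gt0 ?invr_gt0.
have F0 : F 0 = 2 by rewrite /F !mul0r oppr0 expR0.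
have small (C : R) : 1 <= C -> expR (- C) <= 2^-1.
  move=> C1; rewrite expRN lef_pV2 ?posrE ?expR_gt0//.
  by apply: le_trans (expR_ge1Dx _); lra.
have Fq : F q <= 1.
  have qA : 1 <= q * A by rewrite mulrDl mulVf ?gt_eqF// lerDl mulr_ge0 ?invr_ge0 ?ltW.
  have qB : 1 <= q * B by rewrite mulrDl mulVf ?gt_eqF// addrC lerDl mulr_ge0 ?invr_ge0 ?ltW.
  by have := small _ qA; have := small _ qB; rewrite /F; lra.
have [|p] := @IVT _ F 0 q 1 (ltW q0) (continuous_subspaceT F_cont).
  by rewrite F0 ge_min le_max Fq orbT/= ler1n.
rewrite in_itv/= => /andP[p_ge0 _] Fp; exists p => //.
by rewrite lt_neqAle p_ge0 andbT; apply/eqP => p0; move: Fp; rewrite -p0 F0; lra.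
Qed.

Lemma expR_modulated_periodic (R : realType) (g : R -> R) (A B : R) :
    0 < A -> 0 < B -> continuous g -> (forall x, 0 <= g x) ->
    (forall x, g x = g (x + A) + g (x + B)) ->
  exists2 p : R, 0 < p & forall x,
    expR (p * (x + A)) * g (x + A) = expR (p * x) * g x /\
    expR (p * (x + B)) * g (x + B) = expR (p * x) * g x.
Proof.
move=> A0 B0 g_cont g_ge0 gE; have [p p0 pE] := exists_exponent A0 B0.
exists p => //; pose h x : R := expR (p * x) * g x.
have gh x y : g (x + y) = expR (- (p * x)) * (expR (- (p * y)) * h (x + y)).
  by rewrite /h !mulrA -!expRD mulrDr -opprD addNr expR0 mul1r.
have gh0 x : g x = expR (- (p * x)) * h x.
  by rewrite /h mulrA -expRD addNr expR0 mul1r.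
(* At [c := expR (- (p * C))] the quadratic inequality is a positive multiple of midpoint convexity
   of [h]. The shifts [C] and [D] stay free so that both orders of [A] and [B] are covered. *)
have cvx C D : (forall x, g x = g (x + C) + g (x + D)) ->
    forall x, h (x + C) *+ 2 <= h (x + C + C) + h x.
  move=> gCD x.
  have := second_difference_ge0 g_ge0 gCD x (expR (- (p * C))).
  rewrite (gh (x + C)) (gh x) (gh0 x) mulrDr opprD expRD.
  set E := expR (- (p * x)); set al := expR (- (p * C)).
  set h0 := h x; set h1 := h (x + C); set h2 := h (x + C + C).
  have -> : E * al * (al * h2) - al *+ 2 * (E * (al * h1)) + al ^+ 2 * (E * h0)
    = (E * al ^+ 2) * (h2 + h0 - h1 *+ 2) by ring.
  by rewrite pmulr_rge0 ?subr_ge0// mulr_gt0 ?exprn_gt0 ?expR_gt0.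
have h_cont : continuous h.
  move=> x; apply: cvgM; last exact: g_cont.
  apply: continuous_comp; last exact: continuous_expR.
  by apply: cvgMr; exact: cvg_id.
apply: (@convex_harmonic_periodic _ h A B _ _ A0 B0 _ _ pE h_cont);
  rewrite ?expR_gt0//.
- move=> x; apply: (mulfI (lt0r_neq0 (expR_gt0 (- (p * x))))).
  by rewrite -gh0 gE mulrDr -!gh.
- exact: cvx gE.
- by apply: (cvx B A) => x; rewrite addrC.
Qed.

(** * Positivity of solutions *)

Lemma coefficient_lt1 (R : realType) (f : R -> R) (d a b : R) :
    {within `[0, +oo[, continuous f} -> f 0 = 0 ->
    (forall t, 0 < t < d -> 0 < f t) -> 0 < d -> 0 < a -> 0 < b ->
    (forall t, 0 <= t -> f t = f (a * t) + f (b * t)) ->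
  a < 1.
Proof.
move=> f_cont f0 f_pos d0 a0 b0 fE; rewrite ltNge; apply/negP => a1.
(* Both [u] and [b * u] lie below [d], so [f] is positive at [u / 2] and at [b * (c / a)] for the
   [c] below. *)
pose u := d / (b + 1).
have b10 : 0 < b + 1 by rewrite addr_gt0.
have u0 : 0 < u by rewrite divr_gt0.
have ud : u * (b + 1) = d by rewrite divfK ?gt_eqF.
(* f (c / a) would exceed the maximum f c of f near 0. *)
have [||c] := @EVT_max _ f 0 (u / 2).
- by rewrite divr_ge0// ltW.
- apply: continuous_subspaceW f_cont => x /=.
  by rewrite !in_itv/= andbT => /andP[].
rewrite in_itv/= => /andP[c0 cu] cmax.
have u20 : 0 < u / 2 by rewrite divr_gt0.
have bu : 0 < u * b by rewrite mulr_gt0.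
have fu : 0 < f (u / 2) by apply: f_pos; rewrite u20/=; lra.
have c_gt0 : 0 < c.
  rewrite lt_neqAle c0 andbT; apply/eqP => c_eq0.
  have := cmax (u / 2); rewrite -c_eq0 f0 in_itv/= (ltW u20) lexx => /(_ isT).
  by rewrite leNgt fu.
have ca0 : 0 < c / a by rewrite divr_gt0.
have cac : c / a <= c by rewrite ler_pdivrMr// ler_peMr.
have := cmax (c / a); rewrite in_itv/= (ltW ca0) (le_trans cac cu) => /(_ isT).
rewrite (fE _ (ltW ca0)) [a * _]mulrC divfK ?gt_eqF// gerDl leNgt f_pos//.
rewrite mulr_gt0//=.
have : b * (c / a) <= b * u by rewrite ler_wpM2l ?(ltW b0)//; lra.
lra.
Qed.

(** Each use of the equation shrinks the arguments at least by the factor [Num.max a b < 1], until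
    all of them lie where [f] is known to be positive. *)
Lemma solution_gt0 (R : realType) (f : R -> R) (d a b : R) :
    {within `[0, +oo[, continuous f} -> f 0 = 0 ->
    (forall t, 0 < t < d -> 0 < f t) -> 0 < d -> 0 < a -> 0 < b ->
    (forall t, 0 <= t -> f t = f (a * t) + f (b * t)) ->
  forall t, 0 < t -> 0 < f t.
Proof.
move=> f_cont f0 f_pos d0 a0 b0 fE.
have a1 : a < 1 by exact: coefficient_lt1 f_cont f0 f_pos d0 a0 b0 fE.
have b1 : b < 1.
  apply: (coefficient_lt1 f_cont f0 f_pos d0 b0 a0) => t t0.
  by rewrite addrC; exact: fE.
pose m := Num.max a b.
have m0 : 0 <= m by rewrite le_max (ltW a0).
have m1 : m < 1 by rewrite gt_max a1.
have step n t : 0 < t -> m ^+ n * t < d -> 0 < f t.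
  elim: n t => [|n IHn] t t0.
    by rewrite expr0 mul1r => td; apply: f_pos; rewrite t0.
  rewrite exprSr -mulrA => lt_d; rewrite fE ?(ltW t0)//.
  by apply: addr_gt0; apply: IHn; rewrite ?mulr_gt0//; apply: le_lt_trans lt_d;
    rewrite ler_wpM2l ?exprn_ge0// ler_wpM2r ?(ltW t0)// le_max lexx ?orbT.
move=> t t0; have : m ^+ n @[n --> \oo] --> 0 by apply: cvg_expr; rewrite ger0_norm.
move=> /cvgrPdist_lt /(_ (d / t)); rewrite divr_gt0// => /(_ isT).
move=> /filter_ex[n]; rewrite sub0r normrN ger0_norm ?exprn_ge0// ltr_pdivlMr//.
exact: step.
Qed.

(** * Return to the multiplicative variable *)

Lemma positive_solution (R : realType) (a b d : R) (f : R -> R) :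
    0 < a -> 0 < b -> {within `[0, +oo[, continuous f} -> f 0 = 0 ->
    0 < d -> (forall t, 0 < t < d -> 0 < f t) ->
    (forall t : R, 0 <= t -> f t = f (a * t) + f (b * t)) ->
  [/\ 0 < a < 1, 0 < b < 1 &
    exists (p : R) (H : R -> R),
      [/\ 0 < p,
          {within `]0, +oo[, continuous H},
          (forall t : R, 0 < t -> H t != 0),
          (forall t : R, 0 < t -> H t = H (a * t) /\ H t = H (b * t)) &
          (forall t : R, 0 < t -> f t = t `^ p * H t)]
      /\ (irrational (ln a / ln b) ->
          exists c : R, forall t : R, 0 < t -> H t = c)].
Proof.
move=> a0 b0 f_cont f0 d0 f_pos fE.
have a1 : a < 1 by exact: (coefficient_lt1 f_cont f0 f_pos d0 a0 b0 fE).
have b1 : b < 1.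
  apply: (coefficient_lt1 f_cont f0 f_pos d0 b0 a0) => t t0.
  by rewrite addrC; exact: fE.
have f_gt0 := solution_gt0 f_cont f0 f_pos d0 a0 b0 fE.
have A0 : 0 < - ln a by rewrite oppr_gt0 ln_lt0// a0.
have B0 : 0 < - ln b by rewrite oppr_gt0 ln_lt0// b0.
pose g x := f (expR (- x)).
have gD c x : 0 < c -> g (x - ln c) = f (c * expR (- x)).
  by move=> c0; rewrite /g opprB expRD lnK ?posrE.
have g_cont : continuous g.
  move=> x; have [f_in _] := (continuous_within_itvcyP _ _).1 f_cont.
  apply: (@continuous_comp _ _ _ (fun x => expR (- x)) f); last first.
    by apply: f_in; rewrite in_itv/= expR_gt0.
  apply: continuous_comp; last exact: continuous_expR.
  by apply: cvgN; exact: cvg_id.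
have [||p p0 hper] := @expR_modulated_periodic _ g _ _ A0 B0 g_cont.
- by move=> x; rewrite ltW// f_gt0// expR_gt0.
- by move=> x; rewrite !gD// /g fE// expR_ge0.
pose h x := expR (p * x) * g x.
have h_cont : continuous h.
  move=> x; apply: cvgM; last exact: g_cont.
  apply: continuous_comp; last exact: continuous_expR.
  by apply: cvgMr; exact: cvg_id.
(* The value [h (- ln t)] is [f t] divided by the power [p] of [t]; the periods of [h] become
   invariance under scaling by [a] and [b]. *)
split; [by rewrite a0|by rewrite b0|exists p, (fun t => h (- ln t))].
split; first split => //.
- rewrite continuous_open_subspace; last exact: interval_open.
  move=> t; rewrite inE/= in_itv/= andbT => t0.
  apply: (@continuous_comp _ _ _ (fun x => - ln x) h); last exact: h_cont.
  by apply: cvgN; exact: continuous_ln.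
- by move=> t t0; rewrite gt_eqF// mulr_gt0 ?expR_gt0// f_gt0// expR_gt0.
- move=> t t0; have [hA hB] := hper (- ln t).
  by rewrite !lnM ?posrE// !opprD ![_ - ln t]addrC /h hA hB.
- move=> t t0; rewrite /h /g opprK lnK ?posrE// /powR gt_eqF// mulrA -expRD.
  by rewrite mulrN subrr expR0 mul1r.
- move=> irr; exists (h 0) => t _.
  apply: (@continuous_incommensurable_periods _ h (- ln a) (- ln b)) => //.
  + by move=> x; case: (hper x).
  + by move=> x; case: (hper x).
  + by rewrite invrN mulrNN.
Qed.

(** * Sign near 0 and conclusion *)

(** Isolation of the zero gives an interval [(0, d)] free of zeros, on which intermediate values
    exclude a change of sign. *)
Lemma classF_sign (R : realType) (f : R -> R) : classF f ->
  exists2 d : R, 0 < d & (forall t, 0 < t < d -> 0 < f t) \/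
                         (forall t, 0 < t < d -> 0 < - f t).
Proof.
move=> [f_cont f0 [_ [V [d /= d0 dV] V0]]]; exists d => //.
have f_neq0 t : 0 < t < d -> f t != 0.
  move=> /andP[t0 td]; apply/eqP => ft0.
  suff : [set 0] t by move=> /= t_eq0; rewrite t_eq0 ltxx in t0.
  rewrite -V0; split; last by split => //; exact: ltW.
  by apply: dV => /=; rewrite sub0r normrN gtr0_norm.
have no_change x y : 0 < x < d -> 0 < y < d -> ~ (f x < 0 < f y).
  (* When [y < x], passing to [- f] and exchanging the points restores the order. *)
  wlog: f f_cont f_neq0 x y {f0 V0} / x <= y => [hwlog xd yd fxy|xy].
    have [xy|yx] := leP x y; first exact: (hwlog f) fxy.
    apply: (hwlog (fun t => - f t) _ _ y x (ltW yx)) => //.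
    - by move=> t; apply: cvgN; exact: f_cont.
    - by move=> t /f_neq0; rewrite oppr_eq0.
    - by rewrite oppr_lt0 oppr_gt0 andbC.
  move=> /andP[x0 xd] /andP[y0 yd] /andP[fx fy].
  have [| |c] := @IVT _ f x y 0 xy.
  - apply: continuous_subspaceW f_cont => z /=.
    by rewrite !in_itv/= andbT => /andP[xz _]; apply: le_trans xz; exact: ltW.
  - by rewrite ge_min le_max (ltW fx) (ltW fy) orbT.
  rewrite in_itv/= => /andP[xc cy] fc; have := f_neq0 c.
  by rewrite fc eqxx (lt_le_trans x0 xc) (le_lt_trans cy yd) => /(_ isT).
have d2 : 0 < d / 2 < d by apply/andP; split; lra.
have := f_neq0 _ d2; rewrite neq_lt => /orP[neg|pos]; [right|left] => t td;
  have := f_neq0 _ td; rewrite neq_lt ?oppr_gt0 => /orP[] // ft.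
- by case: (no_change _ _ d2 td); rewrite neg ft.
- by case: (no_change _ _ td d2); rewrite ft pos.
Qed.

Unset Implicit Arguments.

Theorem theorem1 (R : realType) (a b : R) (f : R -> R)
    (a_gt0 : 0 < a) (b_gt0 : 0 < b) (fF : classF f)
    (f_eq : forall t : R, 0 <= t -> f t = f (a * t) + f (b * t)) :
  [/\ 0 < a < 1, 0 < b < 1 &
    exists (p : R) (H : R -> R),
      [/\ 0 < p,
          {within `]0, +oo[, continuous H},
          (forall t : R, 0 < t -> H t != 0),
          (forall t : R, 0 < t -> H t = H (a * t) /\ H t = H (b * t)) &
          (forall t : R, 0 < t -> f t = t `^ p * H t)]
      /\ (irrational (ln a / ln b) ->
          exists c : R, forall t : R, 0 < t -> H t = c)].
Proof.
have [d d0 [f_pos|f_neg]] := classF_sign fF; case: fF => f_cont f0 _.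
  exact: positive_solution f_cont f0 d0 f_pos f_eq.
(* The equation is linear, so a negative [f] is treated through [- f], and the sign is carried over
   to [H]. *)
have Nf_cont : {within `[0, +oo[, continuous (fun t => - f t)}.
  by move=> t; apply: cvgN; exact: f_cont.
have [||a01 b01 [p [H [[p0 H_cont H_neq0 H_per fH] H_const]]]] :=
  positive_solution a_gt0 b_gt0 Nf_cont _ d0 f_neg.
- by rewrite f0 oppr0.
- by move=> t t0; rewrite f_eq// opprD.
split=> //; exists p, (fun t => - H t); split; first split => //.
- by move=> t; apply: cvgN; exact: H_cont.
- by move=> t t0; rewrite oppr_eq0 H_neq0.
- by move=> t t0; have [<- <-] := H_per t t0.
- by move=> t t0; rewrite mulrN -fH// opprK.
- by move=> /H_const[c Hc]; exists (- c) => t t0; rewrite Hc.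
Qed.
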